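(* If $G$ is a bipartite graph with no induced path on $6$ vertices, then $\operatorname{reg}(G)=\operatorname{im}(G)$.
   Context: $\operatorname{reg}(G)=\max\{j\ge0:\widetilde H_{j-1}(\operatorname{Ind}(G[S]);\Bbbk)\neq0\text{ for some }S\subseteq V(G)\}$ over a field $\Bbbk$ ($\operatorname{Ind}$ = independence complex). $\operatorname{im}(G)$ is the induced matching number: maximum size of a set of edges that are pairwise vertex-disjoint and such that no edge of $G$ joins two of them. *)

(* Defs.v *)
From HB Require Import structures.
From mathcomp Require Import all_boot all_order all_algebra.
Set Implicit Arguments. Unset Strict Implicit. Unset Printing Implicit Defensive.
Import GRing.Theory.

(* A finite simple graph: vertex type T : finType, adjacency e : rel T,
   assumed symmetric and irreflexive in the theorem. *)

Section Graph.
Variables (T : finType) (e : rel T).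

Definition independent (F : {set T}) : bool :=
  [forall x in F, forall y in F, ~~ e x y].

(* faces of size n of the independence complex Ind(G[S]) (including the
   empty face, for reduced homology) *)
Definition faces (S : {set T}) (n : nat) : {set {set T}} :=
  [set F : {set T} | (F \subset S) && independent F && (#|F| == n)].

Variable K : fieldType.

(* Simplicial boundary matrix (row-vector convention) from the chain space
   spanned by faces of size n.+1 to the one spanned by faces of size n.
   Vertices are ordered by enum_rank; removing v from A gives the sign
   (-1)^(number of vertices of A smaller than v). *)
Definition bd (S : {set T}) (n : nat) :
    'M[K]_(#|faces S n.+1|, #|faces S n|) :=
  \matrix_(i < #|faces S n.+1|, j < #|faces S n|)
    (let A : {set T} := enum_val i in let B : {set T} := enum_val j in
     if B \subset A then
       (\sum_(v in A :\: B)
          (-1) ^+ #|[set u in A | (enum_rank u < enum_rank v)%N]| : K)%R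
     else 0%R).

(* reduced homology  H~_{n-1}(Ind(G[S]); K)  (spanned by faces of size n)
   is nonzero: dim C_{n-1} - rank d_{n-1} - rank d_n > 0 *)
Definition hom_nonzero (S : {set T}) (n : nat) : bool :=
  \rank (bd S n) + (if n is m.+1 then \rank (bd S m) else 0%N)
    < #|faces S n|.

(* reg(G) = max { j : H~_{j-1}(Ind(G[S]); K) <> 0 for some S }.
   (j ranges up to #|T|, since there are no faces of larger size.) *)
Definition reg : nat :=
  \max_(j < #|T|.+1 | [exists S : {set T}, hom_nonzero S j]) j.

Definition induced_matching (M : {set T * T}) : bool :=
  [forall p in M, e p.1 p.2] &&
  [forall p in M, forall q in M, (p != q) ==>
     [&& p.1 != q.1, p.1 != q.2, p.2 != q.1, p.2 != q.2,
         ~~ e p.1 q.1, ~~ e p.1 q.2, ~~ e p.2 q.1 & ~~ e p.2 q.2]].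

Definition im : nat :=
  \max_(M : {set T * T} | induced_matching M) #|M|.

Definition bipartite : Prop :=
  exists c : T -> bool, forall x y, e x y -> c x != c y.

Definition has_induced_P6 : Prop :=
  exists p : 'I_6 -> T, injective p /\
    forall i j : 'I_6, e (p i) (p j) = ((i.+1 == j) || (j.+1 == i)).

End Graph.

(* Main.v *)
Require Import Defs.
From mathcomp Require Import all_boot all_order all_algebra.
Set Implicit Arguments. Unset Strict Implicit. Unset Printing Implicit Defensive.
Import GRing.Theory.
Local Open Scope ring_scope.

(** Upper bound, by induction on S with nonvanishing homology on the faces of
    size n + 1: let v have maximal degree in G[S].  If v is isolated, the
    complex is a cone.  Otherwise the long exact sequence of the link and the
    deletion of v gives homology either on S - v or, one degree lower, on
    S - N[v].  In the second case take an induced matching M of size n in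
    S - N[v].  If every neighbour w of v had a neighbour in M, then, as there is
    no induced P6, the sets N(w) restricted to M would form a chain, so all w
    would be adjacent to a common vertex a of M; then N(v) is strictly
    contained in N(a), against maximality.  Hence some edge vw extends M.

    Lower bound: the complex on the ends of an induced matching is an iterated
    suspension of the empty complex.

    Chains are functions on all subsets of T, every chain being uniquely
    c = c' + v * c'' with c' and c'' avoiding v, and
    d(v * m) = m - v * dm. *)

(** * Signed boundary, cones, and the splitting of chains at a vertex *)

Section Chains.
Variables (T : finType) (K : fieldType).
Implicit Types (u v w : T) (A B S : {set T}).
Local Notation chain := {ffun {set T} -> K}.
Implicit Types c d m x y z : chain.

Definition sg v A : K :=
  (-1) ^+ #|[set u in A | (enum_rank u < enum_rank v)%N]|.

(** The boundary of the full simplex on [T], given by its coefficients; the independence complex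
    enters only through the support condition [on]. *)
Definition bnd c : chain :=
  [ffun B : {set T} => \sum_(v | v \notin B) sg v (v |: B) * c (v |: B)].

Definition cone v m : chain :=
  [ffun A : {set T} => if v \in A then sg v A * m (A :\ v) else 0].

(** The part c'' of c = c' + v * c'', with [del v c] as c'. Signs square to one, so multiplying by
    the sign again undoes [cone]. *)
Definition lk v c : chain :=
  [ffun B : {set T} => if v \in B then 0 else sg v (v |: B) * c (v |: B)].

Definition del v c : chain := [ffun B : {set T} => if v \in B then 0 else c B].

Definition avoids v c := forall B, v \in B -> c B = 0.

Lemma sg_sqr v A : sg v A * sg v A = 1.
Proof. by rewrite /sg -exprMn mulrNN mulr1 expr1n. Qed.

Lemma sgD1 u v A : u \in A ->
  sg v A = (-1) ^+ (enum_rank u < enum_rank v)%N * sg v (A :\ u).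
Proof.
move=> uA; rewrite /sg -exprD; congr (_ ^+ _).
rewrite (cardsD1 u) inE uA /=; congr (_ + _)%N.
by apply: eq_card => w; rewrite !inE andbA.
Qed.

(** Exactly one of [u], [v] precedes the other, so exactly one of the two signs changes when the
    other vertex is removed. *)
Lemma sg_swap u v A : u \in A -> v \in A -> u != v ->
  sg u A * sg v A = - (sg v (A :\ u) * sg u (A :\ v)).
Proof.
move=> uA vA uv; rewrite (sgD1 u vA) (sgD1 v uA) mulrACA -exprD.
have -> : ((enum_rank v < enum_rank u) + (enum_rank u < enum_rank v) = 1)%N.
  by case: ltngtP => // /val_inj/enum_rank_inj uv'; rewrite uv' eqxx in uv.
by rewrite expr1 mulN1r mulrC.
Qed.

Lemma bndB c d : bnd (c - d) = bnd c - bnd d.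
Proof.
apply/ffunP => B; rewrite !ffunE -sumrB; apply: eq_bigr => v _.
by rewrite !ffunE mulrBr.
Qed.

Lemma bnd0 : bnd 0 = 0.
Proof. by rewrite -[in LHS](subrr 0) bndB subrr. Qed.

Lemma bndN c : bnd (- c) = - bnd c.
Proof. by rewrite -sub0r bndB bnd0 sub0r. Qed.

Lemma bndD c d : bnd (c + d) = bnd c + bnd d.
Proof. by rewrite -{1}[d]opprK bndB bndN opprK. Qed.

Lemma coneN v c : cone v (- c) = - cone v c.
Proof. by apply/ffunP => B; rewrite !ffunE; case: ifP; rewrite ?oppr0 ?mulrN. Qed.

Lemma cone0 v : cone v 0 = 0.
Proof. by apply/ffunP => B; rewrite !ffunE mulr0 if_same. Qed.

Lemma avoids_bnd v c : avoids v c -> avoids v (bnd c).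
Proof.
move=> ac B vB; rewrite ffunE big1 // => w _.
by rewrite ac ?mulr0 // !inE vB orbT.
Qed.

Lemma avoids_lk v c : avoids v (lk v c).
Proof. by move=> B vB; rewrite ffunE vB. Qed.

Lemma avoids_del v c : avoids v (del v c).
Proof. by move=> B vB; rewrite ffunE vB. Qed.

Lemma avoidsD v c d : avoids v c -> avoids v d -> avoids v (c + d).
Proof. by move=> ac ad B vB; rewrite !ffunE ac // ad // addr0. Qed.

Lemma avoids0 v : avoids v 0.
Proof. by move=> B _; rewrite ffunE. Qed.

Lemma avoidsN v c : avoids v c -> avoids v (- c).
Proof. by move=> ac B vB; rewrite ffunE ac // oppr0. Qed.

Lemma avoids_cone v w c : v != w -> avoids v c -> avoids v (cone w c).
Proof.
by move=> vw ac B vB; rewrite !ffunE ac ?mulr0 ?if_same // !inE vw.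
Qed.

Lemma del_cone_lk v c : c = del v c + cone v (lk v c).
Proof.
apply/ffunP => B; rewrite !ffunE !inE eqxx /=; case: ifP => vB.
  by rewrite add0r setD1K // mulrA sg_sqr mul1r.
by rewrite addr0.
Qed.

Lemma lk_addcone v x y : avoids v x -> avoids v y -> lk v (x + cone v y) = y.
Proof.
move=> ax ay; apply/ffunP => B; rewrite !ffunE; case: ifP => vB.
  by rewrite ay.
by rewrite setU11 ax ?setU11 // add0r mulrA sg_sqr mul1r setU1K ?vB.
Qed.

Lemma addcone_inj v x y x' y' : avoids v x -> avoids v y -> avoids v x' ->
  avoids v y' -> x + cone v y = x' + cone v y' -> x = x' /\ y = y'.
Proof.
move=> ax ay ax' ay' E.
have Ey : y = y' by rewrite -(lk_addcone ax ay) E lk_addcone.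
by split=> //; move: E; rewrite Ey; apply: addIr.
Qed.

Lemma bnd_cone v m : avoids v m -> bnd (cone v m) = m - cone v (bnd m).
Proof.
move=> am; apply/ffunP => B; rewrite !ffunE; case: ifP => vB.
  (* The sum for [bnd m] at [B :\ v] has one extra index, [w = v]; its term is a multiple of [m B],
     which is zero as [m] avoids [v]. *)
  rewrite am // sub0r mulr_sumr -sumrN (bigD1 v (P := fun w => w \notin B :\ v)) /=;
    last by rewrite !inE eqxx.
  rewrite setD1K // am // !mulr0 oppr0 add0r.
  apply: eq_big => [w|w wB].
    by rewrite !inE; case: eqVneq => [->|_]; rewrite ?vB ?andbT.
  have wv : w != v by apply: contraNneq wB => ->.
  have E : (w |: B) :\ v = w |: (B :\ v).
    by apply/setP => u; rewrite !inE; case: eqVneq => // ->; rewrite eq_sym (negbTE wv).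
  rewrite !ffunE inE vB orbT mulrA sg_swap ?inE ?eqxx ?vB ?orbT //.
  by rewrite setU1K // E mulNr mulrA.
rewrite (bigD1 v) ?vB //= big1 ?addr0.
  by rewrite !ffunE setU11 setU1K ?vB // mulrA sg_sqr mul1r subr0.
move=> w /andP[wB wv]; rewrite !ffunE !inE vB eq_sym (negbTE wv) /=.
by rewrite mulr0.
Qed.

(** Induction on the size of a set [S] whose subsets carry the chain. Splitting at some [v] in [S],
    the cone formula gives dd(v * m) = dm - (dm - v * ddm) = v * ddm, and both parts of the chain
    live on [S :\ v]. *)
Lemma bnd_bnd c : bnd (bnd c) = 0.
Proof.
suff H S d : (forall A, ~~ (A \subset S) -> d A = 0) -> bnd (bnd d) = 0.
  by apply: (H setT) => A; rewrite subsetT.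
move: {2}#|S| (erefl #|S|) => k; elim: k S d => [|k IH] S d cS dS.
  have -> : bnd d = 0; last exact: bnd0.
  apply/ffunP => B; rewrite !ffunE big1 // => v _; rewrite dS ?mulr0 //.
  by apply/subsetPn; exists v; rewrite ?setU11 // (cards0_eq cS) inE.
have [v vS] : exists v, v \in S by apply/card_gt0P; rewrite cS.
have cS' : #|S :\ v| = k by move: cS; rewrite (cardsD1 v) vS => -[].
have H0 : bnd (bnd (del v d)) = 0.
  apply: (IH _ _ cS') => A AS; rewrite ffunE; case: ifPn => // vA; apply: dS.
  by apply: contra AS => AS; rewrite subsetD1 AS.
have H1 : bnd (bnd (lk v d)) = 0.
  apply: (IH _ _ cS') => A AS; rewrite ffunE; case: ifPn => // vA.
  rewrite dS ?mulr0 //; apply: contra AS => AS; rewrite subsetD1 vA andbT.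
  exact: subset_trans (subsetUr _ _) AS.
have al := @avoids_lk v d.
rewrite (del_cone_lk v d) !bndD H0 add0r bnd_cone // bndB bnd_cone; last exact: avoids_bnd.
by rewrite H1 cone0 subr0 subrr.
Qed.

(** * Chains of the independence complex of an induced subgraph *)

Variable e : rel T.

(** Chains for all [S] and [n] share one type, so passing to a link or a deletion needs no change of
    basis. *)
Definition on S n c := forall A, A \notin faces e S n -> c A = 0.

Lemma facesP S n A :
  reflect [/\ A \subset S, independent e A & #|A| = n] (A \in faces e S n).
Proof.
rewrite inE; apply: (iffP andP) => [[/andP[-> ->] /eqP]|[-> -> ->]] //.
Qed.

Lemma indepP A :
  reflect (forall x y : T, x \in A -> y \in A -> ~~ e x y) (independent e A).
Proof.
apply: (iffP forall_inP) => [H x y xA yA|H x xA].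
  by move/forall_inP: (H x xA); apply.
by apply/forall_inP => y; apply: H.
Qed.

Lemma indepS A B : A \subset B -> independent e B -> independent e A.
Proof.
by move=> /subsetP AB /indepP H; apply/indepP => x y /AB xB /AB; apply: H.
Qed.

Lemma faces_setU1 S n v B : v \notin B -> v |: B \in faces e S n.+1 ->
  B \in faces e S n.
Proof.
move=> vB /facesP[sS iB]; rewrite cardsU1 vB => -[cB]; apply/facesP; split=> //.
  exact: subset_trans (subsetUr _ _) sS.
exact: indepS (subsetUr _ _) iB.
Qed.

Lemma on_bnd S n c : on S n.+1 c -> on S n (bnd c).
Proof.
move=> onc B nB; rewrite ffunE big1 // => v vB; rewrite onc ?mulr0 //.
by apply: contra nB; apply: faces_setU1.
Qed.

Lemma onB S n c d : on S n c -> on S n d -> on S n (c - d).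
Proof. by move=> oc od A nA; rewrite !ffunE oc // od // subr0. Qed.

Lemma onN S n c : on S n c -> on S n (- c).
Proof. by move=> oc A nA; rewrite !ffunE oc // oppr0. Qed.

Lemma onD S n c d : on S n c -> on S n d -> on S n (c + d).
Proof. by move=> oc od A nA; rewrite !ffunE oc // od // addr0. Qed.

Lemma on_sub S S' n c : S' \subset S -> on S' n c -> on S n c.
Proof.
move=> sS oc A nA; apply: oc; apply: contra nA => /facesP[AS iA cA].
by apply/facesP; split=> //; apply: subset_trans sS.
Qed.

Lemma on_avoids S n c v : v \notin S -> on S n c -> avoids v c.
Proof.
move=> vS oc A vA; apply: oc; apply: contra vS => /facesP[/subsetP AS _ _].
exact: AS.
Qed.

Lemma on_del S n c v : on S n c -> on (S :\ v) n (del v c).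
Proof.
move=> oc A nA; rewrite ffunE; case: ifPn => // vA; apply: oc.
apply: contra nA => /facesP[AS iA cA]; apply/facesP; split=> //.
by rewrite subsetD1 AS.
Qed.

(** Vanishing of reduced homology in degree [n - 1], since [n] counts the vertices of a face. *)
Definition exact_at S n := forall c, on S n c -> bnd c = 0 ->
  exists2 d, on S n.+1 d & bnd d = c.

(** * Exactness from link and deletion, at an isolated vertex, and under suspension *)

Hypotheses (e_sym : symmetric e) (e_irr : irreflexive e).

(* [far v S] carries the link of [v] in the independence complex on [S]. *)
Definition far v S := [set u in S | (u != v) && ~~ e v u].

Lemma on_lk S n c v : on S n.+1 c -> on (far v S) n (lk v c).
Proof.
move=> oc A nA; rewrite ffunE; case: ifPn => // vA; rewrite oc ?mulr0 //.
apply: contra nA => F; have /facesP[AS iA cA] := faces_setU1 vA F.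
case/facesP: F => sS /indepP iS _.
apply/facesP; split=> //; apply/subsetP => u uA; rewrite inE (subsetP AS) //=.
by rewrite (contraNneq _ vA) => [|<-] //=; apply: iS; rewrite ?setU11 // setU1r.
Qed.

Lemma on_cone S S' n m v : v \in S -> S' \subset far v S -> on S' n m ->
  on S n.+1 (cone v m).
Proof.
move=> vS sS om A nA; rewrite ffunE; case: ifP => // vA; rewrite om ?mulr0 //.
apply: contra nA => /facesP[/subsetP AS /indepP iA cA].
have H u : u \in A -> u != v -> u \in far v S.
  by move=> uA uv; apply: (subsetP sS); apply: AS; rewrite !inE uv.
apply/facesP; split; last by rewrite (cardsD1 v) vA cA.
  apply/subsetP => u uA; have [-> //|/(H _ uA)] := eqVneq u v.
  by rewrite inE => /andP[].
apply/indepP => x y xA yA.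
have [->|xv] := eqVneq x v; have [->|yv] := eqVneq y v.
- by rewrite e_irr.
- by have := H _ yA yv; rewrite inE => /and3P[].
- by have := H _ xA xv; rewrite inE e_sym => /and3P[].
by apply: iA; rewrite !inE ?xv ?yv.
Qed.

Lemma far_sub v S : far v S \subset S :\ v.
Proof. by apply/subsetP => u; rewrite !inE => /and3P[-> ->]. Qed.

(** The long exact sequence by hand. A cycle c' + v * c'' has dc'' = 0 and dc' + c'' = 0. Write c''
    = dm on the link; then c' + m is a cycle on the deletion, say equal to dy, and d(y - v * m) = c'
    + v * c''. *)
Lemma exact_step S n v : v \in S -> exact_at (S :\ v) n.+1 ->
  exact_at (far v S) n -> exact_at S n.+1.
Proof.
move=> vS exd exl c oc; rewrite {1}(del_cone_lk v c) bndD.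
have al := @avoids_lk v c; have ad := @avoids_del v c.
rewrite bnd_cone // addrA -coneN => E0.
have [_ /eqP] : bnd (del v c) + lk v c = 0 /\ - bnd (lk v c) = 0.
  apply: (@addcone_inj v) => //; last by rewrite cone0 addr0.
  - by apply: avoidsD => //; apply: avoids_bnd.
  - exact: avoidsN (avoids_bnd al).
  - exact: avoids0.
  - exact: avoids0.
rewrite oppr_eq0 => /eqP E1.
have [m om Em] := exl _ (on_lk oc) E1.
have am : avoids v m by apply: on_avoids om; rewrite !inE eqxx andbF.
have [||d od Ed] := exd (del v c + m).
- by apply: onD (on_del oc) (on_sub (far_sub _ _) om).
- by move: E0; rewrite E1 oppr0 cone0 addr0 bndD Em.
exists (d - cone v m).
  apply: onB; first exact: on_sub (subsetDl _ _) od.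
  exact: on_cone om.
rewrite bndB Ed bnd_cone // Em [RHS](del_cone_lk v c).
by rewrite opprB addrACA subrr addr0.
Qed.

(** A cycle c' + v * c'' has c'' = - dc', so it is the boundary of v * c', which lies in the complex
    because [v] is joined to every face avoiding it. *)
Lemma exact_isolated S n v : v \in S -> far v S = S :\ v -> exact_at S n.
Proof.
move=> vS fS c oc; rewrite {1}(del_cone_lk v c) bndD.
have al := @avoids_lk v c; have ad := @avoids_del v c.
rewrite bnd_cone // addrA -coneN => E0.
have [E _] : bnd (del v c) + lk v c = 0 /\ - bnd (lk v c) = 0.
  apply: (@addcone_inj v) => //; last by rewrite cone0 addr0.
  - by apply: avoidsD => //; apply: avoids_bnd.
  - exact: avoidsN (avoids_bnd al).
  - exact: avoids0.
  - exact: avoids0.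
exists (cone v (del v c)).
  by apply: on_cone (on_del oc) => //; rewrite fS.
move/eqP: E; rewrite addr_eq0 => /eqP E.
by rewrite bnd_cone // E coneN opprK -del_cone_lk.
Qed.

(** The larger complex is the suspension with poles [x] and [y]. For a cycle z on [S], x * z - y * z
    is a cycle; if it bounds d, comparing the parts at [x] shows that z bounds [- lk x d]. *)
Lemma exact_unsuspend S n (x y : T) : x \notin S -> y \notin S -> e x y ->
  (forall u, u \in S -> ~~ e x u && ~~ e y u) ->
  exact_at (x |: (y |: S)) n.+1 -> exact_at S n.
Proof.
move=> xS yS exy far_S ex z oz bz.
have xy : x != y by apply: contraTneq exy => ->; rewrite e_irr.
have ax := on_avoids xS oz; have ay := on_avoids yS oz.
have [||d od Ed] := ex (cone x z - cone y z).
- apply: onB; apply: (on_cone (S' := S)) oz; rewrite ?inE ?eqxx ?orbT //;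
  apply/subsetP => u uS; rewrite !inE uS !orbT /=; have /andP[xu yu] := far_S u uS.
    by rewrite xu andbT; apply: contraNneq xS => <-.
  by rewrite yu andbT; apply: contraNneq yS => <-.
- by rewrite bndB !bnd_cone // bz !cone0 !subr0 subrr.
have al := @avoids_lk x d; have ad := @avoids_del x d.
have [_ E] : bnd (del x d) + lk x d = - cone y z /\ - bnd (lk x d) = z.
  apply: (@addcone_inj x) => //.
  - by apply: avoidsD => //; apply: avoids_bnd.
  - exact: avoidsN (avoids_bnd al).
  - exact: avoidsN (avoids_cone xy ax).
  by rewrite [RHS]addrC -Ed [in RHS](del_cone_lk x d) bndD bnd_cone // coneN addrA.
exists (- lk x d); last by rewrite bndN.
(* Adjacency of [x] and [y] keeps [y] out of the link of [x], which therefore lies in [S]. *)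
apply: onN; apply: on_sub (on_lk od); apply/subsetP => u; rewrite !inE.
by case: eqVneq => //= _; case: eqVneq => [->|_ /andP[]] //; rewrite exy.
Qed.

(** * Boundary matrices: rank conditions and exactness *)

Lemma bnd_matrix S n c : on S n.+1 c ->
  (\row_i c (enum_val i)) *m bd e K S n = \row_j bnd c (enum_val j).
Proof.
move=> oc; apply/rowP => j; rewrite !mxE ffunE; set B := enum_val j.
have cB : #|B| = n by have /facesP[] := enum_valP j.
pose F A : K := if B \subset A then \sum_(v in A :\: B) sg v A else 0.
transitivity (\sum_(A in faces e S n.+1) c A * F A).
  by rewrite [RHS]big_enum_val; apply: eq_bigr => i _; rewrite !mxE.
(* As [#|B| = n], a face [A] of size [n.+1] contains [B] iff [A = v |: B] for some [v] outside [B];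
   exchanging the sums then yields [bnd c] at [B]. *)
transitivity (\sum_(A in faces e S n.+1)
    \sum_(v | v \notin B) if A == v |: B then sg v A * c A else 0).
  apply: eq_bigr => A /facesP[_ _ cA]; rewrite /F -big_mkcondr /=.
  case: ifPn => BA.
    rewrite mulr_sumr; apply: eq_big => [v|v _]; last exact: mulrC.
    rewrite inE; case: (boolP (v \in B)) => //= vB.
    apply/idP/eqP => [vA|->]; last exact: setU11.
    apply/esym/eqP; rewrite eqEcard subUset sub1set vA BA cardsU1 vB cA cB.
    by rewrite leqnn.
  rewrite mulr0 big1 // => v /andP[_ /eqP EA].
  by rewrite EA subsetUr in BA.
rewrite exchange_big; apply: eq_bigr => v vB.
rewrite -big_mkcondr /=.
have [fA|nA] := boolP (v |: B \in faces e S n.+1).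
  by rewrite (big_pred1 (v |: B)) // => A /=; case: eqVneq => [->|]; rewrite ?andbF ?fA.
rewrite oc // mulr0 big1 // => A /andP[fA /eqP EA].
by rewrite -EA fA in nA.
Qed.

End Chains.

(** The row space of [A] lies in the kernel of [B], of dimension [q - \rank B]; comparing dimensions
    decides whether the two are equal. *)
Lemma rank_exactP (K : fieldType) p q r (A : 'M[K]_(p, q)) (B : 'M_(q, r)) :
  A *m B = 0 ->
  reflect (forall u : 'rV_q, u *m B = 0 -> exists w, u = w *m A)
    (~~ (\rank A + \rank B < q)%N).
Proof.
move=> AB; have sA : (A <= kermx B)%MS by apply/sub_kermxP.
have -> : ~~ (\rank A + \rank B < q)%N = (kermx B <= A)%MS.
  rewrite -leqNgt -(mxrank_leqif_sup sA).
  by rewrite eqn_leq mxrankS //= mxrank_ker leq_subLR addnC.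
apply: (iffP idP) => [sB u /sub_kermxP uB|H].
  by apply/submxP/(submx_trans uB).
apply/row_subP => i; apply/submxP/H/sub_kermxP/row_sub.
Qed.

Lemma hom_exactP (K : fieldType) (T : finType) (e : rel T) (S : {set T}) n :
  reflect (exact_at K e S n) (~~ hom_nonzero e K S n).
Proof.
suff: ~~ hom_nonzero e K S n <-> exact_at K e S n.
  by move=> E; apply: (iffP idP); apply E.
have toc m (u : 'rV[K]_#|faces e S m|) : exists2 c : {ffun {set T} -> K},
    on e S m c & \row_i c (enum_val i) = u.
  exists [ffun A => \sum_i (if enum_val i == A then u 0 i else 0)].
    move=> A nA; rewrite ffunE big1 // => i _; case: eqP => // EA.
    by rewrite -EA enum_valP in nA.
  apply/rowP => i; rewrite mxE ffunE (bigD1 i) //= eqxx big1 ?addr0 // => k ki.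
  by rewrite (inj_eq enum_val_inj) (negbTE ki).
have row_inj m (c d : {ffun {set T} -> K}) : on e S m c -> on e S m d ->
    (\row_(i < #|faces e S m|) c (enum_val i)) = \row_i d (enum_val i) -> c = d.
  move=> oc od /rowP E; apply/ffunP => A.
  have [fA|nA] := boolP (A \in faces e S m); last by rewrite oc ?od.
  by have := E (enum_rank_in fA A); rewrite !mxE enum_rankK_in.
(* For [n = 0] a matrix without columns stands for the outgoing boundary, matching the rank 0 in
   [hom_nonzero]. *)
pose r := if n is m.+1 then #|faces e S m| else 0%N.
have [B EB BP] : exists2 B : 'M[K]_(#|faces e S n|, r),
    (if n is m.+1 then \rank (bd e K S m) else 0%N) = \rank B
    & forall c, on e S n c -> (\row_i c (enum_val i)) *m B = 0 <-> bnd c = 0.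
  rewrite {}/r; case: n => [|m].
    exists 0; first by rewrite mxrank0.
    move=> c oc; rewrite mulmx0; split=> // _; apply/ffunP => A.
    rewrite !ffunE big1 // => v vA; rewrite oc ?mulr0 //.
    by apply/negP => /facesP[_ _]; rewrite cardsU1 vA.
  exists (bd e K S m) => // c oc; rewrite bnd_matrix //.
  split=> [E|->]; last by apply/rowP => i; rewrite !mxE ffunE.
  apply: row_inj (on_bnd oc) _ _ => [A _|]; first by rewrite ffunE.
  by rewrite E; apply/rowP => i; rewrite !mxE ffunE.
have dd : bd e K S n *m B = 0.
  suff H (u : 'rV_#|faces e S n.+1|) : u *m bd e K S n *m B = 0.
    by apply/row_matrixP => i; rewrite row0 rowE mulmxA H.
  have [c oc <-] := toc _ u.
  by rewrite bnd_matrix //; apply/BP; [apply: on_bnd | apply: bnd_bnd].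
rewrite /hom_nonzero EB; split=> [/(rank_exactP dd) H c oc bc|H].
  have [w Ew] := H _ ((BP _ oc).2 bc).
  have [d od Ed] := toc _ w; exists d => //.
  by apply: row_inj (on_bnd od) oc _; rewrite Ew -Ed bnd_matrix.
apply/(rank_exactP dd) => u uB.
have [c oc Ec] := toc _ u; have [|d od Ed] := H c oc.
  by apply/BP => //; rewrite Ec.
by exists (\row_i d (enum_val i)); rewrite bnd_matrix // Ed Ec.
Qed.

Lemma hom_nonzero_face (K : fieldType) (T : finType) (e : rel T) (S : {set T}) n :
  hom_nonzero e K S n -> exists A, A \in faces e S n.
Proof. by move=> /(leq_ltn_trans (leq0n _))/card_gt0P. Qed.

(** * Induced matchings and the homology on their ends *)

Section Graphs.
Variables (T : finType) (e : rel T).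
Hypotheses (e_sym : symmetric e) (e_irr : irreflexive e).

Lemma induced_matchingP (M : {set T * T}) :
  reflect ((forall p, p \in M -> e p.1 p.2) /\
           (forall p q, p \in M -> q \in M -> p != q ->
             [&& p.1 != q.1, p.1 != q.2, p.2 != q.1, p.2 != q.2,
                 ~~ e p.1 q.1, ~~ e p.1 q.2, ~~ e p.2 q.1 & ~~ e p.2 q.2]))
          (induced_matching e M).
Proof.
apply: (iffP andP) => -[H1 H2]; split.
- by move=> p pM; apply: (forall_inP H1).
- by move=> p q pM qM pq; apply: (implyP (forall_inP (forall_inP H2 p pM) q qM)).
- by apply/forall_inP.
by apply/forall_inP => p pM; apply/forall_inP => q qM; apply/implyP; apply: H2.
Qed.

Lemma induced_matching0 : induced_matching e set0.
Proof. by apply/induced_matchingP; split=> p; rewrite ?inE // => q; rewrite inE. Qed.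

Lemma induced_matchingS (M N : {set T * T}) :
  N \subset M -> induced_matching e M -> induced_matching e N.
Proof.
move=> /subsetP NM /induced_matchingP[H1 H2]; apply/induced_matchingP.
by split=> [p /NM|p q /NM pM /NM]; [apply: H1 | apply: H2].
Qed.

Lemma induced_matchingU1 (M : {set T * T}) v w :
  e v w -> induced_matching e M ->
  (forall p, p \in M -> [&& v != p.1, v != p.2, w != p.1, w != p.2,
                 ~~ e v p.1, ~~ e v p.2, ~~ e w p.1 & ~~ e w p.2]) ->
  induced_matching e ((v, w) |: M).
Proof.
move=> vw /induced_matchingP[H1 H2] H; apply/induced_matchingP; split.
  by move=> p; rewrite !inE => /predU1P[->|/H1].
move=> p q /setU1P[->|pM] /setU1P[->|qM]; first by rewrite eqxx.
- by move=> _; apply: H.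
- move=> _; have := H p pM.
  rewrite /= !(eq_sym p.1) !(eq_sym p.2) !(e_sym p.1) !(e_sym p.2).
  case/and5P=> -> -> -> -> /and4P[-> -> -> ->] //.
exact: H2.
Qed.

Definition ends (M : {set T * T}) : {set T} :=
  [set u | [exists p in M, (u == p.1) || (u == p.2)]].

Lemma endsP (M : {set T * T}) u :
  reflect (exists2 p, p \in M & u = p.1 \/ u = p.2) (u \in ends M).
Proof.
rewrite inE; apply: (iffP exists_inP) => -[p pM b]; exists p => //.
  by case/orP: b => /eqP; [left | right].
by apply/orP; case: b => ->; [left | right].
Qed.

Lemma hom_nonzero_ends (K : fieldType) (M : {set T * T}) :
  induced_matching e M -> hom_nonzero e K (ends M) #|M|.
Proof.
move: {2}#|M| (erefl #|M|) => n; elim: n M => [|n IH] M cM.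
  move=> _; rewrite (cards0_eq cM) cards0.
  have E0 : ends set0 = set0.
    by apply/setP => u; rewrite [RHS]inE; apply/endsP => -[p]; rewrite inE.
  (* The chain with coefficient 1 at the empty face is a cycle; it bounds nothing, since [set0] has
     no vertex to span a larger face. *)
  rewrite E0; apply: contraT => /hom_exactP/(_ [ffun A => (A == set0)%:R]) [].
  - move=> A; rewrite ffunE; case: eqP => // -> /negP[]; apply/facesP; split.
    + exact: sub0set.
    + by apply/indepP => x y; rewrite inE.
    by rewrite cards0.
  - apply/ffunP => B; rewrite !ffunE big1 // => v _; rewrite ffunE.
    by rewrite setU_eq0 -cards_eq0 cards1 mulr0.
  move=> d od /ffunP/(_ set0); rewrite !ffunE eqxx big1 => [/eqP|v _].
    by rewrite eq_sym oner_eq0.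
  rewrite od ?mulr0 //; apply/negP => /facesP[/subsetP/(_ v)].
  by rewrite !inE eqxx => /(_ isT).
move=> iM; have [p pM] : exists p, p \in M by apply/card_gt0P; rewrite cM.
have iM' := induced_matchingS (subsetDl M [set p]) iM.
have cM' : #|M :\ p| = n by move: cM; rewrite (cardsD1 p) pM => -[].
have [H1 H2] := induced_matchingP _ iM.
have E : ends M = p.1 |: (p.2 |: ends (M :\ p)).
  apply/setP => u; rewrite !inE; apply/idP/idP.
    case/exists_inP => q qM; have [-> /orP[] -> //|qp uq] := eqVneq q p.
      by rewrite orbT.
    by apply/orP; right; apply/orP; right; apply/exists_inP; exists q; rewrite // !inE qp.
  case/or3P => [up|up|/exists_inP[q]].
  - by apply/exists_inP; exists p; rewrite ?up.
  - by apply/exists_inP; exists p; rewrite ?up ?orbT.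
  by rewrite !inE => /andP[_ qM] uq; apply/exists_inP; exists q.
have sep q : q \in M :\ p -> [&& p.1 != q.1, p.1 != q.2, p.2 != q.1, p.2 != q.2,
    ~~ e p.1 q.1, ~~ e p.1 q.2, ~~ e p.2 q.1 & ~~ e p.2 q.2].
  by case/setD1P => qp qM; apply: H2; rewrite // eq_sym.
rewrite cM E; apply: contraT => /hom_exactP ex.
have := IH _ cM' iM'; rewrite cM' => /negP[]; apply/negP/hom_exactP.
apply: (exact_unsuspend e_sym e_irr _ _ (H1 p pM) _ ex).
- by apply/endsP => -[q /sep/and5P[n1 n2 _ _ _] [] /eqP]; apply/negP.
- by apply/endsP => -[q /sep/and5P[_ _ n1 n2 _] [] /eqP]; apply/negP.
by move=> u /endsP[q /sep/and5P[_ _ _ _ /and4P[n1 n2 n3 n4]] [] ->]; apply/andP.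
Qed.

(** * Bipartite graphs without induced P6: matchings from homology *)

Variable c : T -> bool.
Hypothesis c_col : forall x y, e x y -> c x != c y.

Lemma same_colour x y : c x = c y -> e x y = false.
Proof. by move=> cxy; apply/negP => /c_col; rewrite cxy eqxx. Qed.

(** Colours alternate along the path, so the four listed non-edges are exactly the non-consecutive
    pairs of opposite colours; the colouring excludes all other chords. *)
Lemma induced_P6 x0 x1 x2 x3 x4 x5 :
  e x0 x1 -> e x1 x2 -> e x2 x3 -> e x3 x4 -> e x4 x5 ->
  ~~ e x0 x3 -> ~~ e x0 x5 -> ~~ e x1 x4 -> ~~ e x2 x5 ->
  has_induced_P6 e.
Proof.
move=> e01 e12 e23 e34 e45 /negbTE n03 /negbTE n05 /negbTE n14 /negbTE n25.
have flip x y : e x y -> c y = ~~ c x by move/c_col; case: (c x); case: (c y).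
have [c1 c2] := (flip _ _ e01, flip _ _ e12).
have [c3 c4 c5] := And3 (flip _ _ e23) (flip _ _ e34) (flip _ _ e45).
pose s := [:: x0; x1; x2; x3; x4; x5]; pose p (i : 'I_6) := nth x0 s i.
have adj i j : e (p i) (p j) = ((i.+1 == j) || (j.+1 == i))%N.
  wlog ij : i j / (i <= j)%N => [H|].
    by case/orP: (leq_total i j) => ?; [exact: H | rewrite e_sym H // orbC].
  case: i j ij => [[|[|[|[|[|[|//]]]]]] ?] [[|[|[|[|[|[|//]]]]]] ?] //= _;
    rewrite /p /= ?e01 ?e12 ?e23 ?e34 ?e45 ?n03 ?n05 ?n14 ?n25 //;
    by rewrite same_colour // ?c5 ?c4 ?c3 ?c2 ?c1 ?negbK.
(* Injectivity follows from adjacency: the six vertices of P6 have pairwise different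
   neighbourhoods. *)
exists p; split=> // i j pij; apply: val_inj.
have E (k : 'I_6) : ((i.+1 == k) || (k.+1 == i) = (j.+1 == k) || (k.+1 == j))%N.
  by rewrite -!adj pij.
move: (E (@Ordinal 6 0 isT)) (E (@Ordinal 6 1 isT)) (E (@Ordinal 6 2 isT)).
move: (E (@Ordinal 6 3 isT)) (E (@Ordinal 6 4 isT)) (E (@Ordinal 6 5 isT)).
by case: i j {E pij} => [[|[|[|[|[|[|//]]]]]] ?] [[|[|[|[|[|[|//]]]]]] ?].
Qed.

(** Supplies the [w] for which [(v, w)] extends [M]; being in [far e v S], the ends of [M] are
    already apart from [v]. *)
Lemma extend_matching (S : {set T}) v (M : {set T * T}) :
  ~ has_induced_P6 e ->
  (forall a, a \in S -> #|[set u in S | e a u]| <= #|[set u in S | e v u]|)%N ->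
  (exists2 w, w \in S & e v w) ->
  induced_matching e M -> ends M \subset far e v S ->
  exists w, [/\ w \in S, e v w & forall u, u \in ends M -> ~~ e w u].
Proof.
move=> noP6 vmax [w1 w1S vw1] /induced_matchingP[H1 H2] /subsetP sM.
pose W := [set u in S | e v u].
have [/exists_inP[w]|/exists_inPn no] :=
  boolP [exists w in W, [forall u in ends M, ~~ e w u]].
  by rewrite inE => /andP[wS vw] /forall_inP; exists w.
(* [pt p], [pb p]: the ends of [p] on the side of [v] and on the opposite side *)
pose pt (p : T * T) := if c p.1 == c v then p.1 else p.2.
pose pb (p : T * T) := if c p.1 == c v then p.2 else p.1.
pose N w := [set p in M | e w (pt p)].
have ptE p : p \in M -> pt p \in ends M.
  by move=> pM; apply/endsP; exists p; rewrite // /pt; case: ifP; [left | right].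
have pbE p : p \in M -> pb p \in ends M.
  by move=> pM; apply/endsP; exists p; rewrite // /pb; case: ifP; [right | left].
have pbt p : p \in M -> e (pb p) (pt p).
  by move=> pM; rewrite /pb /pt; case: ifP => _; [rewrite e_sym|]; apply: H1.
(* A neighbour of [w] among the ends of [M] has the colour of [v], hence is the [pt] of its edge. *)
have N0 w : w \in W -> exists p, p \in N w.
  move=> wW; have /forall_inPn[u /endsP[p pM up] /negPn wu] := no w wW.
  exists p; rewrite inE pM /=; suff <- : u = pt p by [].
  have cu : c u = c v.
    move: wW; rewrite inE => /andP[_ /c_col]; move/c_col: wu.
    by case: (c u) (c v) (c w) => [] [] [].
  have := c_col (H1 p pM); rewrite /pt -cu.
  by case: up => ->; rewrite ?eqxx // => /negbTE->.
have w1W : w1 \in W by rewrite inE w1S.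
(* A [w0] with fewest edges in [N w0] serves as the bottom of the chain; any [p] in [N w0] gives the
   common neighbour [pt p]. *)
case: (arg_minnP (fun w => #|N w|) w1W) => w0 /= w0W w0min; have {}w0W : w0 \in W := w0W.
have [p pN0] := N0 _ w0W.
have /andP[pM w0p] : (p \in M) && e w0 (pt p) by move: pN0; rewrite inE.
have allW w : w \in W -> e w (pt p).
  move=> wW; apply: contraT => nwp; case: noP6.
  (* Otherwise [N w] would be a proper subset of [N w0], missing [p], against minimality. The
     induced path is then [pb p], [pt p], [w0], [v], [w], [pt q]. *)
  have [q qN nq] : exists2 q, q \in N w & q \notin N w0.
    apply/subsetPn; apply: contraL (w0min w wW) => sN; rewrite -ltnNge.
    apply: proper_card; apply/properP; split=> //; exists p => //.
    by rewrite inE pM.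
  move: qN nq; rewrite !inE => /andP[qM wq]; rewrite qM /= => nw0q.
  have pq : p != q by apply: contraNneq nwp => ->.
  have := H2 p q pM qM pq.
  have /setIdP[w0S vw0] := w0W; have /setIdP[wS vw] := wW.
  case/and5P=> [_ _ _ _ /and4P[n11 n12 n21 n22]].
  apply: (@induced_P6 (pb p) (pt p) w0 v w (pt q)) => //.
  - exact: pbt.
  - by rewrite e_sym.
  - by rewrite e_sym.
  - by have := sM _ (pbE _ pM); rewrite inE e_sym => /and3P[].
  - by rewrite /pb /pt; do 2!case: ifP.
  - by rewrite e_sym.
have /sM : pt p \in ends M := ptE p pM.
rewrite inE => /andP[ptS _].
(* Every neighbour of [v] in [S] is one of [pt p], and [pb p] is a neighbour of [pt p] only, so
   [pt p] has larger degree than [v]. *)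
have := vmax _ ptS; rewrite leqNgt => /negP[]; apply: proper_card.
have := sM _ (pbE p pM); rewrite inE => /and3P[pbS _ nvb].
apply/properP; split.
  by apply/subsetP => w wW; rewrite inE e_sym allW // andbT; move: wW; rewrite inE => /andP[].
by exists (pb p); rewrite inE pbS /= ?(negbTE nvb) // e_sym pbt.
Qed.

(** The clause on [ends M] carries the induction: a matching inside [far e v S] has no end equal or
    adjacent to [v]. *)
Lemma matching_of_hom (K : fieldType) (S : {set T}) n : ~ has_induced_P6 e ->
  hom_nonzero e K S n ->
  exists M, [/\ induced_matching e M, ends M \subset S & #|M| = n].
Proof.
move=> noP6; have [k] := ubnP #|S|; elim: k S n => // k IH S [|n] Sk hS.
  exists set0; rewrite induced_matching0 cards0; split=> //.
  by apply/subsetP => u /endsP[p]; rewrite inE.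
have [v0 v0S] : exists v0, v0 \in S.
  have [A /facesP[/subsetP AS _ cA]] := hom_nonzero_face hS.
  have /card_gt0P[v0 v0A] : (0 < #|A|)%N by rewrite cA.
  by exists v0; apply: AS.
case: (arg_maxnP (fun v => #|[set u in S | e v u]|) v0S) => v /= vS vmax.
have {}vS : v \in S := vS.
have [/exists_inP nv|/exists_inPn iso] := boolP [exists w in S, e v w]; last first.
  have fS : far e v S = S :\ v.
    apply/setP => u; rewrite !inE; have [uS|] := boolP (u \in S); last by rewrite andbF.
    by rewrite iso ?andbT.
  have /hom_exactP := exact_isolated (K := K) (n := n.+1) e_sym e_irr vS fS.
  by rewrite hS.
have Svk : (#|S :\ v| < k)%N.
  by rewrite -ltnS; apply: leq_ltn_trans Sk; rewrite (cardsD1 v S) vS.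
have [hd|/hom_exactP exd] := boolP (hom_nonzero e K (S :\ v) n.+1).
  have [M [iM sM cM]] := IH _ _ Svk hd.
  by exists M; split=> //; apply: subset_trans sM (subsetDl _ _).
have [hl|/hom_exactP exl] := boolP (hom_nonzero e K (far e v S) n); last first.
  by have /hom_exactP := exact_step e_sym e_irr vS exd exl; rewrite hS.
have fk := leq_ltn_trans (subset_leq_card (far_sub e v S)) Svk.
have [M [iM sM cM]] := IH _ _ fk hl.
have [w [wS vw wM]] := extend_matching noP6 vmax nv iM sM.
exists ((v, w) |: M); split.
- apply: induced_matchingU1 => // p pM.
  have p1 : p.1 \in ends M by apply/endsP; exists p; [|left].
  have p2 : p.2 \in ends M by apply/endsP; exists p; [|right].
  have := subsetP sM _ p1; have := subsetP sM _ p2.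
  rewrite !inE => /and3P[_ n2 m2] /and3P[_ n1 m1].
  rewrite ![v == _]eq_sym n1 n2 m1 m2 !wM //= andbT.
  by apply/andP; split; [apply: contraNneq m1 | apply: contraNneq m2] => <-.
- apply/subsetP => u /endsP[p /setU1P[->|pM]] /=; first by case=> ->.
  move=> up; have /(subsetP sM) : u \in ends M by apply/endsP; exists p.
  by rewrite inE => /andP[].
rewrite cardsU1 cM; case: (boolP (_ \in M)) => // vwM.
have /(subsetP sM) : v \in ends M by apply/endsP; exists (v, w); [|left].
by rewrite !inE eqxx andbF.
Qed.
End Graphs.

Theorem mainTheorem6 (K : fieldType) (T : finType) (e : rel T)
  (e_sym : symmetric e) (e_irr : irreflexive e)
  (e_bip : bipartite e) (noP6 : ~ has_induced_P6 e) :
  reg e K = im e.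
Proof.
case: e_bip => c c_col; apply/eqP; rewrite eqn_leq; apply/andP; split.
  apply/bigmax_leqP => j /existsP[S hS].
  have [M [iM _ <-]] := matching_of_hom e_sym e_irr c_col noP6 hS.
  exact: leq_bigmax_cond.
apply/bigmax_leqP => M iM; have hM := hom_nonzero_ends e_sym e_irr K iM.
(* [reg] ranges over [j] up to [#|T|]; nonzero homology provides a face with [#|M|] vertices, so
   [#|M|] is in range. *)
have MT : (#|M| < #|T|.+1)%N.
  by have [A /facesP[_ _ <-]] := hom_nonzero_face hM; rewrite ltnS max_card.
apply: (@leq_bigmax_cond _ _ (fun j : 'I_#|T|.+1 => nat_of_ord j) (Ordinal MT)).
by apply/existsP; exists (ends M).
Qed.
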